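(* Fix an integer $k \geq 100$ and let $n$ be divisible by $k$ and large enough that Waiter has a winning strategy in the unbiased Waiter-Client $K_k$-factor game on $K_n$. Then $$\tau_{WC}(\mathcal{F}_{n,K_k\text{-fac}},1) \geq 2^{k/6-\frac{k}{\log k}}\,n.$$
   Context: The unbiased Waiter-Client $K_k$-factor game on $K_n$ ($n$ divisible by $k$): initially all edges of $K_n$ are unclaimed. In each round Waiter picks two yet unclaimed edges; Client chooses one of them, which is added to Client's graph, and the other is added to Waiter's graph. Waiter wins if Client's graph eventually contains a $K_k$-factor (a partition of the vertex set into $n/k$ sets of size $k$, each spanning a clique in Client's graph); otherwise Client wins. When Waiter has a winning strategy, $\tau_{WC}(\mathcal{F}_{n,K_k\text{-fac}},1)$ is the number of rounds the game lasts when Waiter tries to win as fast as possible, Client tries to delay her as much as possible, and both play optimally. *)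

(* Defs.v *)
From mathcomp Require Import all_boot.

Set Implicit Arguments.
Unset Strict Implicit.
Unset Printing Implicit Defensive.

Section WaiterClientGame.

Variables (X : finType) (F : {set {set X}}).

Definition client_full (C : {set X}) : bool := [exists A in F, A \subset C].

(* [waiter_wins_in t C W]: when Client holds [C], Waiter holds [W] and
   everything else is unclaimed, Waiter can force Client to own a full winning
   set after at most [t] further rounds.  A round needs two distinct unclaimed
   elements, so the game stops once fewer than two remain. *)
Fixpoint waiter_wins_in (t : nat) (C W : {set X}) : bool :=
  client_full C ||
  (if t is t'.+1 then
     [exists e : X, exists f : X,
        [&& e != f, e \notin C :|: W, f \notin C :|: W,
            waiter_wins_in t' (e |: C) (f |: W)
          & waiter_wins_in t' (f |: C) (e |: W)]]
   else false).

Definition waiter_has_winning_strategy : Prop :=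
  exists t : nat, waiter_wins_in t set0 set0.

(* The number of rounds under optimal play; only meaningful, hence only
   defined, when Waiter has a winning strategy. *)
Definition tau_WC (hwin : waiter_has_winning_strategy) : nat := ex_minn hwin.

End WaiterClientGame.

Definition edge (n : nat) : finType := {e : {set 'I_n} | #|e| == 2}.

Definition clique_edges (n : nat) (P : {set {set 'I_n}}) : {set edge n} :=
  [set e : edge n | [exists B in P, val e \subset B]].

(* Edge sets of the K_k-factors of K_n. *)
Definition clique_factors (n k : nat) : {set {set edge n}} :=
  [set clique_edges P | P : {set {set 'I_n}} in
     [pred P : {set {set 'I_n}} |
        partition P [set: 'I_n] && [forall B in P, #|B| == k]]].

(* Main.v *)
Require Import Defs.
From mathcomp Require Import all_boot all_order all_algebra.
From mathcomp Require Import reals exp.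
From mathcomp Require Import zify lra.

Set Implicit Arguments.
Unset Strict Implicit.
Unset Printing Implicit Defensive.

(** Client keeps a potential summing over pairs [(v, s)] of a vertex and [k - 1]
    positions below [D] in the chronological list of Client's edges at [v].  The
    edges joining two already known neighbours at positions in [s] are the
    current targets of [(v, s)]: the pair dies when Waiter gets a target, and its
    weight, initially [1], doubles when Client claims a target.  If an offered
    edge is a target of [(v, s)], then at most one of Client's two answers keeps
    the pair alive, so one of the answers does not increase the potential.

    Let Client's graph contain a K_k-factor after [t] rounds.  With
    [D = 4kt/n], more than [n/2k] of its cliques have only vertices of degree at
    most [D].  Every triangle has exactly one vertex opposite to its last claimed
    edge, hence in each such clique [B] some vertex [v] is opposite to the last
    edge in at least [C(k,3)/k] triangles; all these last edges were targets of
    the pair [(v, s)] describing [B].  Comparing with the initial potential gives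
    [n/2k * 2^((k-1)(k-2)/6) < n D^(k-1)]. *)

(** * Auxiliary facts on sets and sequences *)

Lemma disjoint_setU1 (T : finType) (x : T) (A B : {set T}) :
  [disjoint x |: A & B] = (x \notin B) && [disjoint A & B].
Proof. by rewrite !disjoints_subset subUset sub1set inE. Qed.

Lemma map_val_pmap_insub (T : Type) (p : pred T) (sT : subType p) (s : seq T) :
  all p s -> map val (pmap insub s : seq sT) = s.
Proof.
move=> ps; rewrite (pmap_filter (insubK sT)); apply/all_filterP.
by apply: sub_all ps => x px; rewrite isSome_insub.
Qed.

(** * Client's potential strategy for targets that grow during play *)

Section AdaptiveTargets.

Variables (X : finType) (F : {set {set X}}) (I : finType).
Variable T : I -> seq X -> {set X}.
Hypothesis T_mono : forall i e h, T i h \subset T i (e :: h).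

Fixpoint gain (i : I) (h : seq X) : nat :=
  if h is e :: h' then gain i h' + (e \in T i h') else 0.

(** Histories list the newest edge first, so [drop (index e h).+1 h] is the history just before the
    latest claim of [e]. *)
Lemma card_le_gain i h :
  #|[set e in h | e \in T i (drop (index e h).+1 h)]| <= gain i h.
Proof.
elim: h => [|x h IH] /=; first by rewrite leqn0 cards_eq0; apply/eqP/setP=> e; rewrite !inE.
apply: leq_trans (_ : #|[set e in h | e \in T i (drop (index e h).+1 h)]
   :|: [set e in [:: x] | e \in T i h]| <= _).
  apply/subset_leq_card/subsetP=> e; rewrite !inE.
  have [->|_] /= := eqVneq e x; first by rewrite drop0 => ->; rewrite orbT.
  by rewrite orbF.
apply: leq_trans (leq_card_setU _ _) (leq_add IH _).
case E: (x \in T i h).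
  by rewrite /= -[X in _ <= X](cards1 x); apply/subset_leq_card/subsetP=> e; rewrite !inE => /andP[].
rewrite leqn0 cards_eq0; apply/eqP/setP=> e; rewrite !inE.
by apply/negP=> /andP[/eqP->]; rewrite E.
Qed.

Definition potential (h : seq X) (W : {set X}) : nat :=
  \sum_i [disjoint T i h & W] * 2 ^ gain i h.

(** If [i] survives both answers, neither edge is a target and its weight stays the same in both; if
    it survives only one, its weight at most doubles there. Either way it contributes at most twice
    its old weight. *)
Lemma potential_step h W e f :
  potential (e :: h) (f |: W) + potential (f :: h) (e |: W)
  <= 2 * potential h W.
Proof.
rewrite /potential -big_split big_distrr /=; apply: leq_sum => i _.
have alive x y : [disjoint T i (x :: h) & y |: W] ->
    [disjoint T i h & W] && (y \notin T i h).
  move=> dis; have := disjointWl (T_mono i x h) dis.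
  by rewrite disjoint_sym disjoint_setU1 disjoint_sym => /andP[-> ->].
case E1: [disjoint _ & f |: W]; case E2: [disjoint _ & e |: W] => //=;
  rewrite ?mul0n ?mul1n ?add0n ?addn0 //.
- have /andP[-> /negbTE fN] := alive _ _ E1; have /andP[_ /negbTE eN] := alive _ _ E2.
  by rewrite fN eN !addn0; lia.
- have /andP[-> _] := alive _ _ E1; rewrite mul1n -expnS leq_exp2l //.
  by case: (_ \in _); lia.
- have /andP[-> _] := alive _ _ E2; rewrite mul1n -expnS leq_exp2l //.
  by case: (_ \in _); lia.
Qed.

(** Client always gives an answer that does not increase the potential; by [potential_step] one of
    the two does. *)
Lemma potential_play t (h : seq X) (W : {set X}) :
    [disjoint [set:: h] & W] -> waiter_wins_in F t [set:: h] W ->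
  exists (h' : seq X) (W' : {set X}), [/\ size h' <= size h + t, [disjoint [set:: h'] & W'],
    client_full F [set:: h'] & potential h' W' <= potential h W].
Proof.
elim: t h W => [|t IH] h W dis /=; rewrite ?orbF => win.
  by exists h, W; rewrite addn0.
case/orP: win => [full|]; first by exists h, W; rewrite leq_addr.
case/existsP=> e /existsP[f /and5P[ef eN fN wine winf]].
have dis' x y : x != y -> x \notin [set:: h] :|: W -> y \notin [set:: h] :|: W ->
    [disjoint [set:: x :: h] & y |: W].
  rewrite !in_setU !negb_or => xy /andP[_ xW] /andP[yh yW].
  rewrite set_cons disjoint_setU1 in_setU1 negb_or xy xW /=.
  by rewrite disjoint_sym disjoint_setU1 yh disjoint_sym.
have step x y : x != y -> x \notin [set:: h] :|: W -> y \notin [set:: h] :|: W ->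
    waiter_wins_in F t (x |: [set:: h]) (y |: W) ->
    potential (x :: h) (y |: W) <= potential h W ->
    exists (h' : seq X) (W' : {set X}), [/\ size h' <= size h + t.+1, [disjoint [set:: h'] & W'],
      client_full F [set:: h'] & potential h' W' <= potential h W].
  move=> xy xN yN win le.
  have [||h' [W' [sz d full pot]]] := IH (x :: h) (y |: W); first exact: dis'.
    by rewrite set_cons.
  by exists h', W'; split=> //; [rewrite addnS | apply: leq_trans le].
have := potential_step h W e f.
have [le _|gt le] := leqP (potential (e :: h) (f |: W)) (potential h W).
  exact: (step e f).
apply: (step f e) => //; first by rewrite eq_sym.
by rewrite -(leq_add2l (potential h W)) addnn -mul2n; apply: leq_trans le; rewrite leq_add2r ltnW.
Qed.

Hypothesis T0 : forall i, T i [::] = set0.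

Theorem adaptive_target_bound t :
    waiter_wins_in F t set0 set0 ->
  exists h, [/\ size h <= t, client_full F [set:: h] &
    \sum_(i | T i h \subset [set:: h]) 2 ^ gain i h <= #|I|].
Proof.
move=> win; have [||h [W [sz dis full pot]]] := @potential_play t [::] set0.
- by rewrite disjoint_sym disjoints_subset sub0set.
- by have -> : [set:: [::]] = set0 :> {set X} by apply/setP=> x; rewrite !inE.
exists h; split=> //; apply: leq_trans (_ : potential h W <= _).
  rewrite big_mkcond; apply: leq_sum => i _; case: ifP => // sub.
  (* Targets that all belong to Client are disjoint from [W], so such an [i] is still alive. *)
  by rewrite (disjointWl sub dis) mul1n.
apply: leq_trans pot _; rewrite -sum1_card; apply: leq_sum => i _.
by rewrite T0 disjoints_subset sub0set.
Qed.

End AdaptiveTargets.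

(** * Last edges of triangles, and the targets they yield *)

Section CliqueGame.

Variable n : nat.
Implicit Types (h : seq (edge n)) (v u : 'I_n) (B : {set 'I_n}) (e x : edge n).

Lemma edge_exists u v : u != v -> exists x : edge n, val x = [set u; v].
Proof. by move=> uv; have P : #|[set u; v]| == 2; [rewrite cards2 uv | exists (exist _ [set u; v] P)]. Qed.

(** Reversed to oldest first: later claims only append, so positions in the star never change. *)
Definition star v h : seq (edge n) := rev (filter (fun x : edge n => v \in val x) h).

Lemma star_cons v x h :
  star v (x :: h) = star v h ++ (if v \in val x then [:: x] else [::]).
Proof. by rewrite /star /=; case: ifP; rewrite ?rev_cons ?cats1 ?cats0. Qed.

Lemma mem_star v h x : (x \in star v h) = (v \in val x) && (x \in h).
Proof. by rewrite /star mem_rev mem_filter. Qed.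

Lemma star_cat v h1 h2 : star v (h1 ++ h2) = star v h2 ++ star v h1.
Proof. by rewrite /star filter_cat rev_cat. Qed.

Lemma sum_size_star h : \sum_v size (star v h) = 2 * size h.
Proof.
elim: h => [|x h IH]; first by rewrite big1.
under eq_bigr => v _ do rewrite star_cons size_cat.
rewrite big_split IH /= mulnS addnC; congr (_ + _).
apply: etrans (eqP (valP x)); rewrite -sum1_card [RHS]big_mkcond; apply: eq_bigr => v _.
by case: ifP.
Qed.

(* Histories list the newest edge first, so a smaller index means later. *)
Definition last_opposite B h v : {set edge n} :=
  [set e : edge n | [&& val e \subset B, v \notin val e &
    [forall x : edge n, (v \in val x) && (val x \subset v |: val e)
                        ==> (index e h < index x h)]]].

Lemma sum_last_opposite B h :
    (forall e, val e \subset B -> e \in h) ->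
  'C(#|B|, 3) <= \sum_(v in B) #|last_opposite B h v|.
Proof.
move=> Bh.
rewrite -cards_draws.
pose U := [set p : 'I_n * edge n | (p.1 \in B) && (p.2 \in last_opposite B h p.1)].
have -> : \sum_(v in B) #|last_opposite B h v| = #|U|.
  under eq_bigr do rewrite -sum1_card.
  rewrite pair_big_dep /= -sum1_card; apply: eq_bigl => p.
  by rewrite [RHS]inE.
apply: leq_trans (leq_imset_card (fun p : 'I_n * edge n => p.1 |: val p.2) _).
apply/subset_leq_card/subsetP=> Q; rewrite inE => /andP[QB /eqP Q3].
have [x0 x0Q] : exists x : edge n, val x \subset Q.
  have /card_gt1P[u [v [uQ vQ uv]]] : 1 < #|Q| by rewrite Q3.
  have [x xE] := edge_exists uv; exists x.
  by rewrite xE; apply/subsetP=> w /set2P[]->.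
(* Of the edges inside the triple [Q], take the last claimed one; the remaining vertex is opposite
   to it, so [Q] is hit. *)
case: (@arg_minnP _ x0 (fun x : edge n => val x \subset Q)
        (fun x => index x h) x0Q) => e eQ emin.
have /cards1P[v Qv] : #|Q :\: val e| == 1.
  by rewrite cardsDS // Q3 (eqP (valP e)).
have vQ : v \in Q :\: val e by rewrite Qv set11.
have QE : Q = v |: val e.
  by rewrite -Qv setUC -{1}(setID Q (val e)) (setIidPr eQ).
apply/imsetP; exists (v, e) => //; rewrite !inE /=.
have [vQ' ve] := setDP vQ.
rewrite (subsetP QB) //= (subset_trans eQ QB) ve /=.
apply/forallP=> x; apply/implyP; rewrite -QE => /andP[vx xQ].
rewrite ltn_neqAle emin // andbT; apply/eqP=> exi.
have xh : x \in h by rewrite Bh // (subset_trans xQ).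
have eh : e \in h by rewrite Bh // (subset_trans eQ).
by move: ve; rewrite -(nth_index x eh) exi nth_index ?vx.
Qed.

(** Averaging over [B]: the binomial coefficient in [sum_last_opposite], divided by [#|B|], is
    [#|B|.-1 * #|B|.-2 / 6]. *)
Lemma exists_last_opposite B h :
    2 < #|B| -> (forall e, val e \subset B -> e \in h) ->
  exists2 v, v \in B &
    #|B|.-1 * #|B|.-2 <= 6 * #|last_opposite B h v|.
Proof.
move=> B3 Bh; apply/exists_inP; apply: contraLR (sum_last_opposite Bh) => none.
rewrite -ltnNge -(ltn_pmul2l (isT : 0 < 6)) big_distrr /=.
have -> : 6 * 'C(#|B|, 3) = \sum_(v in B) #|B|.-1 * #|B|.-2.
  rewrite sum_nat_const mulnC -[6]/(3`!) bin_ffact !ffactnS ffactn0 muln1.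
  by [].
have [w wB] : exists w, w \in B by apply/card_gt0P; lia.
have lt v : v \in B -> 6 * #|last_opposite B h v| < #|B|.-1 * #|B|.-2.
  move=> vB; rewrite ltnNge; apply: contra none => ge.
  by apply/exists_inP; exists v.
rewrite (bigD1 w) //= [X in _ < X](bigD1 w) //= -addSn leq_add ?lt //.
by apply: leq_sum => v /andP[vB _]; apply/ltnW/lt.
Qed.

Section Targets.

Variables (r D : nat).
Implicit Type i : ('I_n * r.-tuple 'I_D)%type.

(** Neighbours are named by position in the star and not by vertex, so that there are only
    [n * D ^ r] pairs. *)
Definition selected i h : {set 'I_n} :=
  [set u | (u != i.1) &&
     has (fun x : edge n => (u \in val x) && (index x (star i.1 h) \in map val i.2))
       (star i.1 h)].

Definition targets i h : {set edge n} := [set e : edge n | val e \subset selected i h].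

Lemma targets_cons i x h : targets i h \subset targets i (x :: h).
Proof.
apply/subsetP=> e; rewrite !inE => /subset_trans; apply.
apply/subsetP=> u; rewrite !inE => /andP[-> /hasP[y yS /andP[uy ys]]] /=.
apply/hasP; exists y; first by rewrite star_cons mem_cat yS.
by rewrite uy star_cons index_cat yS.
Qed.

Lemma targets_nil i : targets i [::] = set0.
Proof.
apply/setP=> e; rewrite !inE; apply/negP=> sub.
have /card_gt0P[u /(subsetP sub)] : 0 < #|val e| by rewrite (eqP (valP e)).
by rewrite inE andbF.
Qed.

Lemma clique_targets B h :
    #|B| = r.+1 -> 1 < r -> (forall e, val e \subset B -> e \in h) ->
    (forall v, v \in B -> size (star v h) <= D) ->
  exists i, [/\ i.1 \in B, targets i h \subset [set:: h]
              & r * r.-1 <= 6 * gain targets i h].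
Proof.
move=> Br r1 Bh BD.
have [|v vB vlast] := exists_last_opposite _ Bh; first by rewrite Br.
rewrite Br /= in vlast.
(* The pair sought consists of [v] and the final star positions [js] of the edges [es] from [v] to
   the rest of [B]. *)
pose es : seq (edge n) := pmap insub [seq [set v; u] | u <- enum (B :\ v)].
have esE x : (x \in es) = (val x \in [seq [set v; u] | u <- enum (B :\ v)]).
  by rewrite mem_pmap_sub.
have es_size : size es = r.
  rewrite -(size_map val) map_val_pmap_insub.
    by rewrite size_map -cardE; move: Br; rewrite (cardsD1 v) vB; case.
  by apply/allP=> _ /mapP[u uB ->]; move: uB; rewrite mem_enum in_setD1 cards2 eq_sym => /andP[->].
have esB x : x \in es -> (v \in val x) && (val x \subset B).
  rewrite esE => /mapP[u uB ->]; rewrite set21 subUset !sub1set vB.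
  by move: uB; rewrite mem_enum => /setD1P[].
pose js : seq 'I_D := pmap insub [seq index x (star v h) | x <- es].
have jsE : map val js = [seq index x (star v h) | x <- es].
  apply: map_val_pmap_insub; apply/allP=> _ /mapP[x xes ->].
  have /andP[vx xB] := esB x xes.
  by apply: leq_trans (BD v vB); rewrite index_mem mem_star vx Bh.
have js_size : size js == r by rewrite -(size_map val) jsE size_map es_size.
pose i : 'I_n * r.-tuple 'I_D := (v, Tuple js_size).
have iB : selected i h \subset B.
  apply/subsetP=> u; rewrite inE /= jsE => /andP[uv /hasP[x xS /andP[ux]]].
  case/mapP=> y yes; have /andP[vy yB] := esB _ yes.
  have yS : y \in star v h by rewrite mem_star vy Bh.
  move=> /(congr1 (nth x (star v h))); rewrite !nth_index // => xy.
  by apply: (subsetP yB); rewrite -xy.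
exists i; split=> //.
  by apply/subsetP=> e; rewrite !inE => /subset_trans/(_ iB)/Bh.
apply: leq_trans vlast _; rewrite leq_mul2l /=.
apply: leq_trans (card_le_gain _ i h).
apply/subset_leq_card/subsetP=> e; rewrite !inE => /and3P[eB ve /forallP last].
rewrite (Bh _ eB) /=; set h' := drop _ h.
apply/subsetP=> u ue; rewrite inE /=.
have uv : u != v by apply: contraNneq ve => <-.
rewrite uv /= jsE; have [x xE] := edge_exists uv.
have xB : val x \subset B.
  by rewrite xE subUset !sub1set vB andbT (subsetP eB).
have xh : x \in h by apply: Bh.
have vx : v \in val x by rewrite xE set22.
have ltx : index e h < index x h.
  by apply: (implyP (last x)); rewrite vx xE subUset !sub1set !inE ue eqxx orbT.
(* When [e] was claimed, the edges from [v] to both its ends were already present, so [e] was a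
   target. *)
have xh' : x \in h'.
  move: (xh); rewrite -{1}(cat_take_drop (index e h).+1 h) mem_cat in_take //.
  by rewrite ltnS leqNgt ltx.
apply/hasP; exists x; first by rewrite mem_star vx.
rewrite xE set21 /=; apply/mapP; exists x.
  rewrite esE; apply/mapP; exists u; last by rewrite xE setUC.
  by rewrite mem_enum in_setD1 uv (subsetP eB).
(* The star of [h'] is a prefix of that of [h], so [x] has the same position in both. *)
rewrite -(cat_take_drop (index e h).+1 h) star_cat index_cat.
by rewrite mem_star vx xh'.
Qed.

End Targets.

End CliqueGame.

(** * Double counting of low-degree cliques against pairs *)

(** Each other block has a vertex of degree at least [D.+1]. If these made up half of the [n / k]
    blocks, the degree sum would exceed [2 * t]. *)
Lemma many_low_degree_blocks n k t D (P : {set {set 'I_n}}) (d : 'I_n -> nat) :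
    0 < n -> partition P [set: 'I_n] -> {in P, forall B : {set 'I_n}, #|B| = k} ->
    \sum_v d v <= 2 * t -> 4 * k * t < D.+1 * n ->
  n < 2 * k * #|[set B in P | [forall v in B, d v <= D]]|.
Proof.
move=> n0 partP cardP sumd Dt; set L := [set B in P | _].
have nE : n = #|P| * k by rewrite -(card_uniform_partition cardP partP) cardsT card_ord.
have LP : L \subset P by apply/subsetP=> B; rewrite inE => /andP[].
have bad : #|P :\: L| * D.+1 <= 2 * t.
  apply: leq_trans sumd; rewrite -sum_nat_const.
  rewrite (eq_bigl (fun v => v \in [set: 'I_n])) => [|v]; last by rewrite inE.
  rewrite (set_partition_big _ partP) /= [X in _ <= X](big_setID L) /=.
  apply: leq_trans (leq_addl _ _); apply: leq_sum => B /setDP[BP].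
  rewrite inE BP negb_forall_in => /exists_inP[v vB]; rewrite -ltnNge => Dv.
  by rewrite (bigD1 v) //= (leq_trans Dv) ?leq_addr.
have cP : #|P| = #|L| + #|P :\: L| by rewrite -(cardsID L P) (setIidPr LP).
rewrite cP in nE; move: #|L| #|P :\: L| bad nE => a b bad nE.
have k0 : 0 < k by case: k nE {cardP Dt} => //; rewrite muln0; lia.
suff ba : b < a by nia.
rewrite ltnNge; apply/negP=> ab; move: Dt; rewrite ltnNge => /negP; apply.
apply: (@leq_trans (2 * k * (b * D.+1))); last by nia.
have -> : 2 * k * (b * D.+1) = D.+1 * (2 * b * k) by nia.
by rewrite nE leq_mul2l leq_mul2r; lia.
Qed.

Lemma exists_degree_bound n k t : 2 < k -> 0 < n ->
    waiter_wins_in (clique_factors n k) t set0 set0 ->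
  exists D f, [/\ D * n <= 4 * k * t, k.-1 * k.-2 <= 6 * f
                & 2 ^ f < 2 * k * D ^ k.-1].
Proof.
(* [D] is rounded down and [f] up, so [4 * k * t < D.+1 * n] holds too, as the block count
   requires. *)
move=> k2 n0 win; pose D := (4 * k * t) %/ n; pose f := (k.-1 * k.-2 + 5) %/ 6.
exists D, f; split; [exact: leq_trunc_div | by rewrite /f; lia |].
have [h [szh full pot]] := adaptive_target_bound
  (@targets_cons n k.-1 D) (@targets_nil n k.-1 D) win.
have [A /imsetP[P]] := exists_inP full.
rewrite inE => /andP[partP /forall_inP Pk] -> sub {A}.
have cardP : {in P, forall B : {set 'I_n}, #|B| = k} by move=> B /Pk/eqP.
have Ph B (e : edge n) : B \in P -> val e \subset B -> e \in h.
  move=> BP eB; have : e \in clique_edges P by rewrite inE; apply/exists_inP; exists B.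
  by move/(subsetP sub); rewrite inE.
pose M := [set i | (targets i h \subset [set:: h])
                   && (f <= gain (@targets n k.-1 D) i h)].
have low := @many_low_degree_blocks n k t D P (fun v => size (star v h)) n0 partP cardP.
rewrite sum_size_star leq_mul2l szh /= in low.
have {low} := low isT (ltn_ceil _ n0); set L := [set B in P | _] => low.
have LM : #|L| <= #|M|.
  (* The vertex [i.1] of a pair determines its block, so distinct blocks need distinct pairs. *)
  apply: leq_trans (leq_imset_card (fun i => pblock P i.1) M).
  apply/subset_leq_card/subsetP=> B; rewrite inE => /andP[BP /forall_inP BD].
  have [|||i [iB iT ig]] := @clique_targets n k.-1 D B h _ _ _ BD.
  - by rewrite cardP // prednK //; lia.
  - by lia.
  - by move=> e; apply: Ph.
  apply/imsetP; exists i; first by rewrite inE iT /f; lia.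
  by rewrite (def_pblock _ BP iB) //; case/and3P: partP.
have Mle : #|M| * 2 ^ f <= n * D ^ k.-1.
  have -> : n * D ^ k.-1 = #|{: 'I_n * k.-1.-tuple 'I_D}|.
    by rewrite card_prod card_tuple !card_ord.
  apply: leq_trans pot; rewrite -sum_nat_const.
  rewrite big_mkcond [X in _ <= X]big_mkcond; apply: leq_sum => i _.
  by rewrite inE; case: ifP => //= /andP[-> fg]; rewrite leq_exp2l.
rewrite -(ltn_pmul2l n0).
apply: (@leq_trans (2 * k * #|L| * 2 ^ f)).
  by rewrite ltn_pmul2r ?expn_gt0.
rewrite [X in _ <= X]mulnCA -mulnA leq_mul2l; apply/orP; right.
by apply: leq_trans Mle; rewrite leq_mul2r LM orbT.
Qed.

(** * Numerical estimates and the bound on the number of rounds *)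

Import Order.TTheory GRing.Theory Num.Theory.
Local Open Scope ring_scope.

Lemma ln2_le_34 (R : realType) : ln 2 <= (3 / 4 : R).
Proof.
rewrite -ler_expR lnK ?posrE //.
(* The inequality [1 + x <= expR x] is applied at [3 / 32], since [(1 + 3 / 32) ^+ 8] exceeds 2. *)
have -> : (3 / 4 : R) = (3 / 32) * 8%:R by lra.
rewrite expRM_natr.
apply: (@le_trans _ _ ((1 + 3 / 32) ^+ 8)); first by lra.
by apply: lerXn2r; rewrite ?nnegrE ?expR_ge0 ?expR_ge1Dx //; lra.
Qed.

Lemma sqr_le_exp2 m : (5 < m)%N -> (3 * (m.+1 * (m + 5)) <= 4 * 2 ^ m)%N.
Proof.
elim: m => // m IH; rewrite ltnS leq_eqVlt => /predU1P[<-//|m5].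
by have := IH m5; rewrite (expnS 2 m); nia.
Qed.

(** The term [k / ln k] in the exponent pays for the factor [16 * k] lost in bounding [4 * D]. With
    [m] the integer part of the binary logarithm of [k], [16 * k] is below [2 ^ (m + 5)], and
    [(m + 5) * ln k <= 2 ^ m <= k] by [sqr_le_exp2]. *)
Lemma ratio_ln_bound (R : realType) (k : nat) : (100 <= k)%N ->
  (16 * k)%:R <= 2 `^ (k%:R / ln k%:R) :> R.
Proof.
move=> hk; have k0 : (0 < k)%N by lia.
set m := trunc_log 2 k.
have /andP[lo hi] := trunc_log_bounds (isT : (1 < 2)%N) k0.
rewrite -/m in lo hi.
have m6 : (5 < m)%N by apply: (@trunc_log_max 2 k 6) => //; apply: leq_trans hk.
have lnk0 : 0 < ln k%:R :> R by rewrite ln_gt0 // ltr1n; lia.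
apply: (@le_trans _ _ (2 `^ (m + 5)%:R)).
  rewrite powR_mulrn // -natrX ler_nat.
  by rewrite -addSnnS expnD mulnC leq_mul2r ltnW ?orbT.
rewrite ler_powR ?ler1n // ler_pdivlMr //.
have lnk : ln k%:R <= m.+1%:R * (3 / 4) :> R.
  apply: (@le_trans _ _ (ln (2 ^+ m.+1))).
    by rewrite ler_ln ?posrE ?ltr0n ?exprn_gt0 // -natrX ler_nat ltnW.
  by rewrite lnXn // -[leLHS]mulr_natl ler_wpM2l // ln2_le_34.
apply: (@le_trans _ _ ((m + 5)%:R * (m.+1%:R * (3 / 4)))).
  by rewrite ler_wpM2l.
apply: (@le_trans _ _ (2 ^ m)%:R); last by rewrite ler_nat.
have := sqr_le_exp2 m6; rewrite -(ler_nat R) !natrM.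
lra.
Qed.

Lemma mul_expn_le_exp2 k D f : (100 <= k)%N ->
    (k.-1 * k.-2 <= 6 * f)%N -> ((4 * D) ^ 6 <= 2 ^ k)%N ->
  (2 * k * D ^ k.-1 <= 2 ^ f)%N.
Proof.
move=> hk hf hD; case: k hk hf hD => [//|r] hk /= hf hD.
(* Sixth powers clear the denominator 6 of the exponents. The factor [2 ^ (12 * r)] then turns [D]
   into [4 * D]; the slack this 4 gives absorbs [2 * k]. *)
rewrite -(@leq_exp2r _ _ 6) // !expnMn -!expnM.
rewrite -(@leq_pmul2l (2 ^ (12 * r))) ?expn_gt0 //.
have e2 : ((4 * D) ^ 6 = 2 ^ 12 * D ^ 6)%N by rewrite expnMn.
have -> : (2 ^ (12 * r) * (2 ^ 6 * r.+1 ^ 6 * D ^ (r * 6))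
   = (2 * r.+1) ^ 6 * ((4 * D) ^ 6) ^ r)%N.
  by rewrite e2 (expnMn (2 ^ 12)) (expnMn 2) -(expnM 2 12 r) -(expnM D 6 r) (mulnC r 6) mulnCA.
have rr : (2 * r.+1 <= 2 ^ r)%N.
  have: (3 < r)%N by lia.
  elim: (r) => // s IH; rewrite ltnS leq_eqVlt => /predU1P[<-//|/IH].
  by rewrite (expnS 2 s); lia.
apply: (@leq_trans ((2 ^ r) ^ 6 * (2 ^ r.+1) ^ r)%N).
  by apply: leq_mul; rewrite leq_exp2r //; lia.
by rewrite -!expnM -!expnD leq_exp2l //; nia.
Qed.

(** With fewer rounds, [4 * D * n <= 16 * k * t] would give [4 * D <= 2 ^ (k / 6)], and
    [mul_expn_le_exp2] would contradict the bound on [2 ^ f]. *)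
Lemma powR_le_rounds (R : realType) (k n D f t : nat) : (100 <= k)%N -> (0 < n)%N ->
    (D * n <= 4 * k * t)%N -> (k.-1 * k.-2 <= 6 * f)%N ->
    (2 ^ f < 2 * k * D ^ k.-1)%N ->
  (2 : R) `^ (k%:R / 6 - k%:R / ln k%:R) * n%:R <= t%:R.
Proof.
move=> hk n0 hD hf hlt; rewrite leNgt; apply/negP=> tlt.
have nR : 0 < n%:R :> R by rewrite ltr0n.
suff /(mul_expn_le_exp2 hk hf) : ((4 * D) ^ 6 <= 2 ^ k)%N by rewrite leqNgt hlt.
set a := (2 : R) `^ (k%:R / 6).
have a0 : 0 <= a by apply: powR_ge0.
have a6 : a ^+ 6 = 2 ^+ k.
  rewrite -powR_mulrn // -powRrM -powR_mulrn //; congr (_ `^ _).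
  by lra.
rewrite -(ler_nat R) !natrX -a6; apply: lerXn2r; rewrite ?nnegrE //.
have b16 := ratio_ln_bound R hk.
set b := (2 : R) `^ (k%:R / ln k%:R) in b16.
have b0 : 0 < b by apply: powR_gt0.
rewrite powRD ?powRN -/a -/b in tlt; last by rewrite pnatr_eq0 implybT.
move: hD; rewrite -(ler_nat R) !natrM => hD.
have k0 : 0 < k%:R :> R by rewrite ltr0n; lia.
rewrite natrM in b16.
rewrite -(ler_pM2r nR).
have ab : 16 * k%:R * (a / b) <= a.
  by rewrite mulrA ler_pdivrMr // mulrC ler_wpM2l.
rewrite -mulrA; apply: (@le_trans _ _ (4 * (4 * k%:R * t%:R))); first by rewrite ler_pM2l.
apply: (@le_trans _ _ (16 * k%:R * (a / b * n%:R))); last by rewrite mulrA ler_pM2r.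
have -> : 4 * (4 * k%:R * t%:R) = 16 * k%:R * t%:R :> R by lra.
by rewrite ler_pM2l ?mulr_gt0 // ltW.
Qed.

Theorem theorem3 (R : realType) (k n : nat) (hk : (100 <= k)%N)
    (hn : (k %| n)%N)
    (hwin : waiter_has_winning_strategy (clique_factors n k)) :
  (2 : R) `^ (k%:R / 6 - k%:R / ln k%:R) * n%:R <= (tau_WC hwin)%:R.
Proof.
have [n0|n0] := posnP n; first by rewrite [X in _ * X%:R]n0 mulr0 ler0n.
rewrite /tau_WC; case: ex_minnP => t win _.
have [|D [f [hD hf hlt]]] := exists_degree_bound _ n0 win; first by lia.
exact: powR_le_rounds hD hf hlt.
Qed.
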